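(* The following algorithm is sound: given a QBF $\Pi.\phi$ with universal variables $U$ and existential variables $E$, if it returns ''true'' then $\Pi.\phi$ is true, and if it returns ''false'' then $\Pi.\phi$ is false. Algorithm: set $A_0:=\{\alpha_0\}$ for an arbitrary full assignment $\alpha_0\colon U\to\{\top,\bot\}$, $S_0:=\emptyset$, $i:=1$. Repeat: (a) check satisfiability of $\bigwedge_{\alpha\in A_{i-1}}\phi^\alpha$; if unsatisfiable return false, otherwise let $\tau$ be a satisfying assignment (assigning all annotated variables $x^\alpha$, $x\in E$, $\alpha\in A_{i-1}$) and set $S_i:=S_{i-1}\cup\{(\tau|_{E^\alpha})^{-\alpha}\mid \alpha\in A_{i-1}\}$; (b) check satisfiability of $\bigwedge_{\sigma\in S_i}\lnot\phi^\sigma$; if unsatisfiable return true, otherwise let $\rho$ be a satisfying assignment (assigning all $x^\sigma$, $x\in U$, $\sigma\in S_i$) and set $A_i:=A_{i-1}\cup\{(\rho|_{U^\sigma})^{-\sigma}\mid\sigma\in S_i\}$; (c) increment $i$.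
   Context: A QBF is $\Pi.\phi$ where $\Pi=Q_1x_1\ldots Q_nx_n$ with $Q_i\in\{\forall,\exists\}$ and pairwise distinct variables, $X=\{x_1,\dots,x_n\}$, $\phi$ a propositional formula over $X$, with the standard semantics; $U$ ($E$) is the set of universally (existentially) quantified variables, and $x_i<_\Pi x_j$ iff $i<j$. An assignment for $Y$ is $\sigma\colon Y\to\{\top,\bot,\epsilon\}$ ($\epsilon$ = unassigned), full if it never takes value $\epsilon$; $\sigma|_Z$ is its restriction to $Z$ (value $\epsilon$ outside $Z$). Instantiation: for an assignment $\sigma$ on a subset of $X$ (extended by $\epsilon$), $\phi^\sigma$ is obtained from $\phi$ by replacing every $x$ with $\sigma(x)\neq\epsilon$ by $\sigma(x)$ (with propositional simplification), and every $x$ with $\sigma(x)=\epsilon$ by the annotated variable $x^\omega$, where $\omega=\sigma(x_{k_1})\cdots\sigma(x_{k_m})$ for $x_{k_1}<_\Pi\cdots<_\Pi x_{k_m}$ all variables preceding $x$, each $\epsilon$ contributing the empty word (empty annotation identifies $x^\omega$ with $x$). Annotated variables with the same name and annotation are the same variable, so different instantiations may share variables. Write $x^\sigma$ for the variable replacing $x$ in $\phi^\sigma$, $E^\sigma=\{x^\sigma: x\in E,\sigma(x)=\epsilon\}$, $U^\sigma=\{x^\sigma:x\in U,\sigma(x)=\epsilon\}$. For an assignment $\tau$ to annotated variables, $\tau^{-\sigma}$ is the assignment $x\mapsto\tau(x^\sigma)$. *)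

(* Defs.v *)
From HB Require Import structures.
From mathcomp Require Import all_boot.

Set Implicit Arguments.
Unset Strict Implicit.
Unset Printing Implicit Defensive.

Inductive form (V : Type) : Type :=
| FConst of bool
| FVar of V
| FNot of form V
| FAnd of form V & form V
| FOr of form V & form V.

Arguments FConst {V} _.

Fixpoint eval (V : Type) (nu : V -> bool) (f : form V) : bool :=
  match f with
  | FConst b => b
  | FVar v => nu v
  | FNot g => ~~ eval nu g
  | FAnd g h => eval nu g && eval nu h
  | FOr g h => eval nu g || eval nu h
  end.

Definition unsat (V : Type) (f : form V) : Prop :=
  ~ exists nu : V -> bool, eval nu f.

(* Partial assignments on V are functions V -> option bool, with None for
   epsilon; an assignment for a set Y is None outside Y. *)
Definition full_assignment (V : Type) (Y : {pred V}) (s : V -> option bool) :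
  Prop := forall v, isSome (s v) = (v \in Y).

Definition restrict (V : Type) (Y : {pred V}) (s : V -> option bool) :
  V -> option bool := fun v => if v \in Y then s v else None.

Definition satisfies (V : Type) (s : V -> option bool) (f : form V) : Prop :=
  forall nu : V -> bool, (forall v b, s v = Some b -> nu v = b) -> eval nu f.

Inductive quant : Type := Forall | Exists.

(* A QBF with n variables is given by Q : 'I_n -> quant and phi : form 'I_n:
   the variable x_(i+1) is the ordinal i, so the prefix order is the order of
   'I_n and the prefix, read from left to right, is enum 'I_n. *)

Definition univ (n : nat) (Q : 'I_n -> quant) : {set 'I_n} :=
  [set x | if Q x is Forall then true else false].

Definition exis (n : nat) (Q : 'I_n -> quant) : {set 'I_n} :=
  [set x | if Q x is Exists then true else false].

Fixpoint qeval (n : nat) (Q : 'I_n -> quant) (phi : form 'I_n)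
    (xs : seq 'I_n) (nu : 'I_n -> bool) : bool :=
  match xs with
  | [::] => eval nu phi
  | x :: xs' =>
    let branch b := qeval Q phi xs' [eta nu with x |-> b] in
    match Q x with
    | Forall => branch true && branch false
    | Exists => branch true || branch false
    end
  end.

(* The initial valuation is irrelevant: every variable is quantified, hence
   overwritten. *)
Definition qbf_true (n : nat) (Q : 'I_n -> quant) (phi : form 'I_n) : Prop :=
  qeval Q phi (enum 'I_n) (fun=> false).

Notation asg n := {ffun 'I_n -> option bool}.

(* (x, w) is the annotated variable x^w. *)
Notation avar n := ('I_n * seq bool)%type.

(* pmap drops the None values, i.e. epsilon contributes the empty word. *)
Definition annot (n : nat) (s : asg n) (x : 'I_n) : avar n :=
  (x, pmap s [seq y : 'I_n <- enum 'I_n | y < x]).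

Definition simplNot (V : Type) (f : form V) : form V :=
  if f is FConst b then FConst (~~ b) else FNot f.

Definition simplAnd (V : Type) (f g : form V) : form V :=
  match f, g with
  | FConst b, _ => if b then g else FConst false
  | _, FConst b => if b then f else FConst false
  | _, _ => FAnd f g
  end.

Definition simplOr (V : Type) (f g : form V) : form V :=
  match f, g with
  | FConst b, _ => if b then FConst true else g
  | _, FConst b => if b then FConst true else f
  | _, _ => FOr f g
  end.

(* phi^s, with elimination of the constants as propositional simplification *)
Fixpoint inst (n : nat) (phi : form 'I_n) (s : asg n) : form (avar n) :=
  match phi with
  | FConst b => FConst b
  | FVar x => if s x is Some b then FConst b else FVar (annot s x)
  | FNot f => simplNot (inst f s)
  | FAnd f g => simplAnd (inst f s) (inst g s)
  | FOr f g => simplOr (inst f s) (inst g s)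
  end.

(* Y^s = { x^s | x in Y, s(x) = epsilon } *)
Definition annot_set (n : nat) (Y : {set 'I_n}) (s : asg n) : {pred avar n} :=
  [pred v | [exists x in Y, (s x == None) && (v == annot s x)]].

(* the union of the Y^s for s in B *)
Definition annot_sets (n : nat) (Y : {set 'I_n}) (B : {set asg n}) :
    {pred avar n} :=
  [pred v | [exists s in B, v \in annot_set Y s]].

(* t^{-s} *)
Definition unannot (n : nat) (t : avar n -> option bool) (s : asg n) : asg n :=
  [ffun x => t (annot s x)].

Definition inst_conj (n : nat) (phi : form 'I_n) (A : {set asg n}) :
    form (avar n) :=
  \big[@FAnd (avar n)/FConst true]_(a in A) inst phi a.

Definition inst_neg_conj (n : nat) (phi : form 'I_n) (S : {set asg n}) :
    form (avar n) :=
  \big[@FAnd (avar n)/FConst true]_(s in S) FNot (inst phi s).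

Definition extract (n : nat) (Y : {set 'I_n}) (t : avar n -> option bool)
    (B : {set asg n}) : {set asg n} :=
  [set unannot (restrict (annot_set Y s) t) s | s in B].

(* Step (a) with a satisfiable check: A = A_(i-1), S = S_(i-1), S' = S_i *)
Definition step_a (n : nat) (Q : 'I_n -> quant) (phi : form 'I_n)
    (A S S' : {set asg n}) : Prop :=
  exists tau : avar n -> option bool,
    [/\ full_assignment (annot_sets (exis Q) A) tau,
        satisfies tau (inst_conj phi A)
      & S' = S :|: extract (exis Q) tau A].

(* Step (b) with a satisfiable check: S = S_i, A = A_(i-1), A' = A_i *)
Definition step_b (n : nat) (Q : 'I_n -> quant) (phi : form 'I_n)
    (S A A' : {set asg n}) : Prop :=
  exists rho : avar n -> option bool,
    [/\ full_assignment (annot_sets (univ Q) S) rho,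
        satisfies rho (inst_neg_conj phi S)
      & A' = A :|: extract (univ Q) rho S].

(* reach Q phi i A S: some run enters iteration i with A_(i-1) = A and
   S_(i-1) = S.  The choices of alpha_0, tau and rho are arbitrary. *)
Inductive reach (n : nat) (Q : 'I_n -> quant) (phi : form 'I_n) :
    nat -> {set asg n} -> {set asg n} -> Prop :=
| reach_init (alpha0 : asg n) :
    full_assignment (mem (univ Q)) alpha0 -> reach Q phi 1 [set alpha0] set0
| reach_next (i : nat) (A S A' S' : {set asg n}) :
    reach Q phi i A S -> step_a Q phi A S S' -> step_b Q phi S' A A' ->
    reach Q phi i.+1 A' S'.

(* returns Q phi b: some run terminates with result b. *)
Inductive returns (n : nat) (Q : 'I_n -> quant) (phi : form 'I_n) :
    bool -> Prop :=
| returns_false (i : nat) (A S : {set asg n}) :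
    reach Q phi i A S -> unsat (inst_conj phi A) -> returns Q phi false
| returns_true (i : nat) (A S S' : {set asg n}) :
    reach Q phi i A S -> step_a Q phi A S S' ->
    unsat (inst_neg_conj phi S') -> returns Q phi true.

(* Main.v *)
Require Import Defs.
From mathcomp Require Import all_boot.

(** Every assignment collected in [A_i] is full on [U], so an annotated
    existential variable records exactly the universal moves preceding it.  A
    Skolem strategy for a true QBF is therefore a single valuation of the
    annotated variables, and it satisfies [phi^alpha] for all [alpha] at once;
    hence an unsatisfiable conjunction refutes the QBF.  Dually, a Herbrand
    strategy for a false QBF falsifies [phi^sigma] for all [sigma] full on [E]. *)

Set Implicit Arguments.
Unset Strict Implicit.
Unset Printing Implicit Defensive.

Lemma eq_eval (V : Type) (mu nu : V -> bool) (f : form V) :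
  mu =1 nu -> eval mu f = eval nu f.
Proof. by move=> e; elim: f => //= [f ->|f -> g ->|f -> g ->]. Qed.

Lemma eval_simplNot (V : Type) (nu : V -> bool) (f : form V) :
  eval nu (simplNot f) = ~~ eval nu f.
Proof. by case: f. Qed.

Lemma eval_simplAnd (V : Type) (nu : V -> bool) (f g : form V) :
  eval nu (simplAnd f g) = eval nu f && eval nu g.
Proof. by case: f => [[]|?|?|? ?|? ?]; case: g => [[]|?|?|? ?|? ?] //=; rewrite ?andbT ?andbF. Qed.

Lemma eval_simplOr (V : Type) (nu : V -> bool) (f g : form V) :
  eval nu (simplOr f g) = eval nu f || eval nu g.
Proof. by case: f => [[]|?|?|? ?|? ?]; case: g => [[]|?|?|? ?|? ?] //=; rewrite ?orbT ?orbF. Qed.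

Lemma eval_bigFAnd (V I : Type) (nu : V -> bool) (r : seq I) (P : pred I)
    (F : I -> form V) :
  eval nu (\big[@FAnd V/FConst true]_(i <- r | P i) F i) =
  \big[andb/true]_(i <- r | P i) eval nu (F i).
Proof. exact: (big_morph (eval nu)). Qed.

Section Expansion.

Variables (n : nat) (Q : 'I_n -> quant) (phi : form 'I_n).

(** Here [nu] acts as a strategy against [s]: its reply at [x] depends on [s] only through the word
    of values assigned before [x]. *)
Definition play (nu : avar n -> bool) (s : asg n) (x : 'I_n) : bool :=
  if s x is Some b then b else nu (annot s x).

Lemma eval_inst (nu : avar n -> bool) (s : asg n) (f : form 'I_n) :
  eval nu (inst f s) = eval (play nu s) f.
Proof.
elim: f => //= [x|f IH|f IHf g IHg|f IHf g IHg].
- by rewrite /play; case: (s x).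
- by rewrite eval_simplNot IH.
- by rewrite eval_simplAnd IHf IHg.
- by rewrite eval_simplOr IHf IHg.
Qed.

Lemma eval_inst_conj (nu : avar n -> bool) (A : {set asg n}) :
  (forall a, a \in A -> eval (play nu a) phi) -> eval nu (inst_conj phi A).
Proof.
move=> h; rewrite eval_bigFAnd big_all_cond; apply/allP => a _ /=.
by apply/implyP => /h; rewrite eval_inst.
Qed.

Lemma eval_inst_neg_conj (nu : avar n -> bool) (S : {set asg n}) :
  (forall s, s \in S -> ~~ eval (play nu s) phi) ->
  eval nu (inst_neg_conj phi S).
Proof.
move=> h; rewrite eval_bigFAnd big_all_cond; apply/allP => s _ /=.
by apply/implyP => /h; rewrite eval_inst.
Qed.

(* The player for outcome [c] owns the other variables. *)
Definition opponent (c : bool) : {set 'I_n} := if c then univ Q else exis Q.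

Lemma in_opponentN (c : bool) (x : 'I_n) :
  (x \in opponent (~~ c)) = (x \notin opponent c).
Proof. by case: c; rewrite !inE; case: (Q x). Qed.

Lemma qeval_opponent (c : bool) (x : 'I_n) (xs : seq 'I_n)
    (mu : 'I_n -> bool) :
  x \in opponent c -> qeval Q phi (x :: xs) mu = c ->
  forall b, qeval Q phi xs [eta mu with x |-> b] = c.
Proof.
case: c; rewrite !inE /=; case: (Q x) => // _.
  by case/andP => ht hf [].
by move/negbT; rewrite negb_or => /andP[/negbTE ht /negbTE hf] [].
Qed.

Lemma qeval_player (c : bool) (x : 'I_n) (xs : seq 'I_n)
    (mu : 'I_n -> bool) :
  x \notin opponent c -> qeval Q phi (x :: xs) mu = c ->
  exists b, qeval Q phi xs [eta mu with x |-> b] = c.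
Proof.
case: c; rewrite !inE /=; case: (Q x) => // _.
  by case/orP => h; [exists true | exists false].
by move/negbT; rewrite negb_and => /orP[] /negbTE h; [exists true | exists false].
Qed.

(* The strategy for a suffix [xs] of the prefix only reads the opponent's moves
   inside [xs]; an opponent move on the head selects one of two strategies for
   the tail. *)
Lemma strategy_suffix (c : bool) (xs : seq 'I_n) (mu : 'I_n -> bool) :
  sorted (fun x y : 'I_n => x < y) xs -> qeval Q phi xs mu = c ->
  exists g : avar n -> bool, forall s : asg n,
    full_assignment (mem (opponent c)) s ->
    eval (fun y => if y \in xs then
                     if s y is Some b then b
                     else g (y, pmap s [seq z : 'I_n <- xs | z < y])
                   else mu y) phi = c.
Proof.
have tr : transitive (fun x y : 'I_n => x < y).
  by move=> y x z; apply: ltn_trans.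
elim: xs mu => [|x xs IH] mu.
  by move=> _ h; exists (fun=> false) => s _ /=.
move=> srt; have /allP lt_x := order_path_min tr srt.
have {}IH := IH _ (path_sorted srt).
have x_xs : x \notin xs by apply/negP => /lt_x; rewrite ltnn.
case: (boolP (x \in opponent c)) => Wx h.
  have [gt Hgt] := IH _ (qeval_opponent Wx h true).
  have [gf Hgf] := IH _ (qeval_opponent Wx h false).
  (* As [x] precedes all of [xs], the word of every later variable starts with the opponent's move
     at [x]; that letter picks the substrategy, which reads the rest. The default [false] is never
     read, since [s x] is defined. *)
  exists (fun v => if v.2 is b :: w then (if b then gt else gf) (v.1, w)
                   else false) => s fs.
  have := fs x; rewrite Wx; case sx: (s x) => [[]|//] _;
    [rewrite -[RHS](Hgt s fs) | rewrite -[RHS](Hgf s fs)];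
    apply: eq_eval => y /=; rewrite inE;
    (case: eqP => [->|_] /=; first by rewrite (negbTE x_xs) sx);
    by case: ifP => // /lt_x xy; rewrite xy /= sx.
have [b hb] := qeval_player Wx h.
have [g Hg] := IH _ hb.
(* The player's own move is a constant, and since [s x] is [None] it adds no letter, so [g] reads
   the same words as before. *)
exists (fun v => if v.1 == x then b else g v) => s fs.
have := fs x; rewrite [RHS](negbTE Wx); case sx: (s x) => [//|] _.
rewrite -[RHS](Hg s fs); apply: eq_eval => y /=; rewrite inE.
case: eqP => [->|_] /=; first by rewrite (negbTE x_xs) sx.
by case: ifP => // /lt_x xy; rewrite xy /= sx.
Qed.

Lemma strategy (c : bool) :
  qeval Q phi (enum 'I_n) (fun=> false) = c ->
  exists nu : avar n -> bool, forall s : asg n,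
    full_assignment (mem (opponent c)) s -> eval (play nu s) phi = c.
Proof.
have srt : sorted (fun x y : 'I_n => x < y) (enum 'I_n).
  by have := iota_ltn_sorted 0 n; rewrite -val_enum_ord sorted_map.
(* On the whole prefix the words read by [g] are the annotations of [annot], and the initial
   valuation is never consulted. *)
case/(strategy_suffix srt) => g Hg; exists g => s /Hg h.
by rewrite -[RHS]h; apply: eq_eval => y; rewrite mem_enum.
Qed.

Definition all_full (Y : {set 'I_n}) (B : {set asg n}) : Prop :=
  forall s, s \in B -> full_assignment (mem Y) s.

(** Each [s] in [B] is undefined exactly on the other side's variables, so precisely these have a
    copy in the domain of [t]. *)
Lemma all_full_extract (c : bool) (t : avar n -> option bool)
    (B : {set asg n}) :
  all_full (opponent c) B ->
  full_assignment (annot_sets (opponent (~~ c)) B) t ->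
  all_full (opponent (~~ c)) (extract (opponent (~~ c)) t B).
Proof.
move=> fB ft _ /imsetP[s Bs ->] x; rewrite ffunE /restrict.
have annot_in : x \in opponent (~~ c) ->
    annot s x \in annot_set (opponent (~~ c)) s.
  move=> Wx; apply/exists_inP; exists x => //; rewrite eqxx andbT.
  have : isSome (s x) = false.
    by rewrite (fB s Bs x); apply/negbTE; rewrite -in_opponentN.
  by case: (s x).
(* An annotated variable keeps its name, so [annot s] is injective. *)
have -> : (annot s x \in annot_set (opponent (~~ c)) s) =
          (x \in opponent (~~ c)).
  by apply/idP/idP => // /exists_inP[y Wy /andP[_ /eqP[-> _]]].
transitivity (x \in opponent (~~ c)) => //.
case: ifPn => // Wx; rewrite ft.
by apply/exists_inP; exists s => //; apply: annot_in.
Qed.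

Lemma all_fullU (Y : {set 'I_n}) (B C : {set asg n}) :
  all_full Y B -> all_full Y C -> all_full Y (B :|: C).
Proof. by move=> fB fC s /setUP[/fB | /fC]. Qed.

Lemma step_a_full (A S S' : {set asg n}) :
  all_full (univ Q) A -> all_full (exis Q) S -> step_a Q phi A S S' ->
  all_full (exis Q) S'.
Proof.
move=> fA fS [tau [ft _ ->]]; apply: all_fullU => //.
exact: (@all_full_extract true).
Qed.

Lemma step_b_full (S A A' : {set asg n}) :
  all_full (exis Q) S -> all_full (univ Q) A -> step_b Q phi S A A' ->
  all_full (univ Q) A'.
Proof.
move=> fS fA [rho [ft _ ->]]; apply: all_fullU => //.
exact: (@all_full_extract false).
Qed.

(** This loop invariant makes [strategy] applicable to every collected assignment. *)
Lemma reach_full (i : nat) (A S : {set asg n}) :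
  reach Q phi i A S -> all_full (univ Q) A /\ all_full (exis Q) S.
Proof.
elim=> [a fa|{}i {}A {}S A' S' _ [fA fS] sa sb].
  by split=> s; rewrite inE // => /eqP->.
have fS' := step_a_full fA fS sa.
by split; [apply: step_b_full sb|].
Qed.

End Expansion.

Theorem theorem1 (n : nat) (Q : 'I_n -> quant) (phi : form 'I_n) :
  (returns Q phi true -> qbf_true Q phi) /\
  (returns Q phi false -> ~ qbf_true Q phi).
Proof.
split=> r; inversion_clear r as [i A S rch uns|i A S S' rch sa uns];
  have [fA fS] := reach_full rch.
  (* Were the QBF false, a Herbrand valuation would satisfy the conjunction of negations over
     [S']. *)
  have fS' := step_a_full fA fS sa.
  apply/negPn/negP => /negbTE /strategy[nu Hnu]; apply: uns; exists nu.
  by apply: eval_inst_neg_conj => s /fS' fs; rewrite Hnu.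
(* Dually, a Skolem valuation would satisfy the conjunction over [A]. *)
move=> /strategy[nu Hnu]; apply: uns; exists nu.
by apply: eval_inst_conj => s /fA fs; rewrite Hnu.
Qed.
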